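(* For every prime $p$, there exists a rank-$1$ cancellative and torsion-free commutative monoid $M$ such that $M$ is a q-GCD monoid but the monoid algebra $\mathbb{F}_p[M]$ is not a q-GCD domain.
   Context: A monoid means a cancellative commutative semigroup with identity. It is torsion-free if $nb=nc$ (additive notation) with $n\ge 1$ implies $b=c$. The rank of $M$ is $\dim_{\mathbb{Q}} (\mathbb{Q}\otimes_{\mathbb{Z}} \mathcal{G}(M))$, where $\mathcal{G}(M)$ is the Grothendieck (difference) group of $M$; a torsion-free monoid has rank $1$ iff it is isomorphic to a nontrivial additive submonoid of $\mathbb{Q}$. For a nonempty finite subset $S$ of a monoid $M$ (multiplicative notation), a common divisor $d\in M$ of $S$ is a maximal common divisor (MCD) of $S$ if the only common divisors of $\{s/d : s\in S\}$ in $M$ are the units (invertible elements) of $M$; in additive notation, $s/d$ is replaced by $s-d$. $M$ is a q-GCD monoid if every nonempty finite subset of $M$ has at most one MCD up to associates. An integral domain is a q-GCD domain if its multiplicative monoid of nonzero elements is a q-GCD monoid. $\mathbb{F}_p[M]$ is the monoid algebra of $M$ over the field $\mathbb{F}_p$ with $p$ elements: polynomial expressions in $x$ with exponents in $M$ and coefficients in $\mathbb{F}_p$; it is an integral domain. *)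

(* Defs.v *)
From HB Require Import structures.
From mathcomp Require Import all_boot all_algebra finmap boolp.
From mathcomp Require Import monalg.

Set Implicit Arguments.
Unset Strict Implicit.
Unset Printing Implicit Defensive.

Import GRing.Theory.
Local Open Scope fset_scope.
Local Open Scope quotient_scope.
Local Open Scope ring_scope.

(** * Maximal common divisors in a submonoid [P] of a commutative monoid

   [P] is [predT] for a monoid [M] itself, and the set of nonzero elements for
   (the multiplicative monoid of) an integral domain. *)

Section MaximalCommonDivisors.

Variables (T : eqType) (e : T) (op : Monoid.com_law e) (P : {pred T}).

Definition divides (d x : T) : Prop := exists2 y, y \in P & x = op d y.

Definition is_unit (u : T) : Prop :=
  u \in P /\ exists2 v, v \in P & op u v = e.

Definition associates (x y : T) : Prop := exists2 u, is_unit u & y = op x u.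

Definition common_divisor (S : T -> Prop) (d : T) : Prop :=
  d \in P /\ forall x, S x -> divides d x.

(* {x / d : x in S}, the quotients being taken inside P *)
Definition quotients (S : T -> Prop) (d y : T) : Prop :=
  y \in P /\ exists2 x, S x & x = op d y.

Definition is_MCD (S : T -> Prop) (d : T) : Prop :=
  common_divisor S d /\ forall c, common_divisor (quotients S d) c -> is_unit c.

Definition q_GCD : Prop :=
  forall s : seq T, s != [::] -> {subset s <= P} ->
  forall d d' : T, is_MCD (fun x => x \in s) d -> is_MCD (fun x => x \in s) d' ->
  associates d d'.

End MaximalCommonDivisors.

Definition q_GCD_monoid (M : nmodType) : Prop :=
  q_GCD (+%R : Monoid.com_law (0 : M)) predT.

(* Meant for integral domains; the absence of zero divisors is deliberately not
   a conjunct, since that would make the negation easier to satisfy. *)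
Definition q_GCD_domain (R : comNzRingType) : Prop :=
  q_GCD ( *%R : Monoid.com_law (1 : R)) [pred x | x != 0].

Definition cancellative (M : nmodType) : Prop :=
  forall a b c : M, a + b = a + c -> b = c.

Definition torsion_free (M : nmodType) : Prop :=
  forall (n : nat) (b c : M), (1 <= n)%N -> b *+ n = c *+ n -> b = c.

(** * The free R-module on A modulo the relations [a + b] = [a] + [b]

   It is the universal R-module with an additive map from A (see
   [linearization_universal]): for R = int and a monoid A it is the
   Grothendieck group of A, and for an abelian group A it is the extension of
   scalars of A from the integers to R. *)

Section Linearization.

Variables (R : nzRingType) (A : nmodType).

Definition add_relator (a b : A) : {malg R[A]} :=
  << a + b >> - << a >> - << b >>.

Definition add_relations : {pred {malg R[A]}} := fun x =>
  `[< exists s : seq (R * (A * A)),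
        x = \sum_(t <- s) t.1 *: add_relator t.2.1 t.2.2 >].

Lemma add_relations0 : 0 \in add_relations.
Proof. by apply/asboolP; exists [::]; rewrite big_nil. Qed.

Lemma add_relationsD : {in add_relations &, forall x y, x + y \in add_relations}.
Proof.
move=> x y /asboolP[s ->] /asboolP[t ->].
by apply/asboolP; exists (s ++ t); rewrite big_cat.
Qed.

Lemma add_relationsZ (c : R) : {in add_relations, forall x, c *: x \in add_relations}.
Proof.
move=> x /asboolP[s ->]; apply/asboolP; exists [seq (c * t.1, t.2) | t <- s].
by rewrite big_map scaler_sumr; apply: eq_bigr => t _; rewrite scalerA.
Qed.

Lemma add_relationsN : {in add_relations, forall x, - x \in add_relations}.
Proof. by move=> x xP; rewrite -scaleN1r add_relationsZ. Qed.

Definition lin_rel (x y : {malg R[A]}) : bool := x - y \in add_relations.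

Lemma lin_rel_refl : reflexive lin_rel.
Proof. by move=> x; rewrite /lin_rel subrr add_relations0. Qed.

Lemma lin_rel_sym : symmetric lin_rel.
Proof.
by move=> x y; apply/idP/idP => /add_relationsN; rewrite opprB.
Qed.

Lemma lin_rel_trans : transitive lin_rel.
Proof.
by move=> y x z xy yz; rewrite /lin_rel -(subrKA y) add_relationsD.
Qed.

Canonical lin_rel_equiv :=
  EquivRel lin_rel lin_rel_refl lin_rel_sym lin_rel_trans.

Definition linearization : Type := {eq_quot lin_rel}.

HB.instance Definition _ : EqQuotient _ lin_rel linearization :=
  EqQuotient.on linearization.
HB.instance Definition _ := Choice.on linearization.

Lemma lin_repr (x : {malg R[A]}) :
  repr (\pi_linearization x) - x \in add_relations.
Proof.
have : repr (\pi_linearization x) == x %[mod linearization] by rewrite reprK.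
by rewrite eqmodE.
Qed.

Definition lin_zero : linearization := lift_cst linearization 0.
Canonical pi_lin_zero_morph := PiConst lin_zero.

Definition lin_opp := lift_op1 linearization -%R.
Lemma pi_lin_opp : {morph \pi_linearization : x / - x >-> lin_opp x}.
Proof.
move=> x; unlock lin_opp; apply/eqmodP; rewrite /= /lin_rel -opprD.
by rewrite add_relationsN // -opprB add_relationsN // lin_repr.
Qed.
Canonical pi_lin_opp_morph := PiMorph1 pi_lin_opp.

Definition lin_add := lift_op2 linearization +%R.
Lemma pi_lin_add : {morph \pi_linearization : x y / x + y >-> lin_add x y}.
Proof.
move=> x y; unlock lin_add; apply/eqmodP; rewrite /= /lin_rel -opprB.
by rewrite add_relationsN // opprD addrACA add_relationsD ?lin_repr.
Qed.
Canonical pi_lin_add_morph := PiMorph2 pi_lin_add.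

Definition lin_scale (c : R) := lift_op1 linearization ( *:%R c).
Lemma pi_lin_scale c : {morph \pi_linearization : x / c *: x >-> lin_scale c x}.
Proof.
move=> x; unlock lin_scale; apply/eqmodP; rewrite /= /lin_rel -scalerBr.
by rewrite add_relationsZ // -opprB add_relationsN // lin_repr.
Qed.
Canonical pi_lin_scale_morph c := PiMorph1 (pi_lin_scale c).

Lemma lin_addA : associative lin_add.
Proof.
by elim/quotW=> x; elim/quotW=> y; elim/quotW=> z; rewrite !piE addrA.
Qed.

Lemma lin_addC : commutative lin_add.
Proof. by elim/quotW=> x; elim/quotW=> y; rewrite !piE addrC. Qed.

Lemma lin_add0 : left_id lin_zero lin_add.
Proof. by elim/quotW=> x; rewrite !piE add0r. Qed.

Lemma lin_addN : left_inverse lin_zero lin_opp lin_add.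
Proof. by elim/quotW=> x; rewrite !piE addNr. Qed.

HB.instance Definition _ :=
  GRing.isZmodule.Build linearization lin_addA lin_addC lin_add0 lin_addN.

Lemma lin_scaleA a b v : lin_scale a (lin_scale b v) = lin_scale (a * b) v.
Proof. by elim/quotW: v => x; rewrite !piE scalerA. Qed.

Lemma lin_scale1 : left_id 1 lin_scale.
Proof. by elim/quotW=> x; rewrite !piE scale1r. Qed.

Lemma lin_scaleDr : right_distributive lin_scale +%R.
Proof.
by move=> a; elim/quotW=> x; elim/quotW=> y; rewrite /+%R /= !piE scalerDr.
Qed.

Lemma lin_scaleDl v : {morph lin_scale^~ v : a b / a + b}.
Proof.
by move=> a b; elim/quotW: v => x; rewrite /+%R /= !piE scalerDl.
Qed.

HB.instance Definition _ := GRing.Zmodule_isLmodule.Build R linearization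
  lin_scaleA lin_scale1 lin_scaleDr lin_scaleDl.

Definition lin_of (a : A) : linearization := \pi_linearization << a >>.

Lemma lin_pi_is_linear : linear (\pi_linearization : {malg R[A]} -> linearization).
Proof. by move=> c x y; rewrite /+%R /= /*:%R /= !piE. Qed.

Lemma lin_piE (x : {malg R[A]}) :
  \pi_linearization x = \sum_(k <- msupp x) x@_k *: lin_of k.
Proof.
pose pi := GRing.isLinear.Build _ _ _ _ _ lin_pi_is_linear.
pose piL : {linear {malg R[A]} -> linearization} :=
  HB.pack (\pi_linearization : {malg R[A]} -> linearization) pi.
rewrite {1}[x]monalgE -[\pi_linearization _]/(piL _) linear_sum.
apply: eq_bigr => k _; rewrite -[lin_of k]/(piL _) -linearZ; congr (piL _).
by apply/malgP => k'; rewrite !(mcoeffZ, mcoeffU) mulr_natr.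
Qed.

Lemma lin_ofD : {morph lin_of : a b / a + b}.
Proof.
move=> a b; rewrite {2 3}/lin_of [RHS]/+%R /= !piE.
apply/eqmodP/asboolP; exists [:: (1, (a, b))].
by rewrite big_seq1 scale1r /= /add_relator opprD addrA.
Qed.

Theorem linearization_universal (W : lmodType R) (f : {additive A -> W}) :
  exists2 g : {linear linearization -> W},
    forall a, g (lin_of a) = f a &
    forall g' : {linear linearization -> W},
      (forall a, g' (lin_of a) = f a) -> g' =1 g.
Proof.
pose h (x : {malg R[A]}) := \sum_(k <- msupp x) x@_k *: f k.
have hE (d : {fset A}) x : msupp x `<=` d -> h x = \sum_(k <- d) x@_k *: f k.
  move=> sub; apply: big_fset_incl => // k _ /mcoeff_outdom ->.
  by rewrite scale0r.
have h_lin : linear h.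
  move=> c x y; pose d := msupp x `|` msupp y.
  rewrite (hE d x) ?fsubsetUl // (hE d y) ?fsubsetUr // (hE d); last first.
    apply: fsubset_trans (msuppD_le _ _) _.
    by apply: fsetSU; apply: msuppZ_le.
  rewrite scaler_sumr -big_split; apply: eq_bigr => k _ /=.
  by rewrite mcoeffD mcoeffZ scalerDl scalerA.
pose hm := GRing.isLinear.Build _ _ _ _ _ h_lin.
pose hL : {linear {malg R[A]} -> W} := HB.pack h hm.
have hU a : hL << a >> = f a.
  by rewrite /= (hE [fset a] _ msuppU_le) big_seq_fset1 mcoeffUU scale1r.
have hR a b : hL (add_relator a b) = 0.
  by rewrite /add_relator !linearB !hU raddfD addrAC addrK subrr.
have h0 x : x \in add_relations -> hL x = 0.
  move=> /asboolP[s ->]; rewrite linear_sum big1 // => t _.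
  by rewrite linearZ hR; apply: scaler0.
pose g (v : linearization) := hL (repr v).
have gE x : g (\pi_linearization x) = hL x.
  by apply/subr0_eq; rewrite -linearB h0 ?lin_repr.
have g_lin : linear g.
  move=> c; elim/quotW=> x; elim/quotW=> y.
  by rewrite -lin_pi_is_linear !gE linearP.
pose gm := GRing.isLinear.Build _ _ _ _ _ g_lin.
pose gL : {linear linearization -> W} := HB.pack g gm.
exists gL => [a|g' g'E]; first by rewrite /= gE hU.
elim/quotW=> x; rewrite lin_piE !linear_sum; apply: eq_bigr => k _.
by rewrite !linearZ g'E /= gE hU.
Qed.

End Linearization.

Definition grothendieck_group (M : nmodType) : zmodType := linearization int M.

Definition rat_tensor (G : zmodType) : lmodType rat := linearization rat G.

Definition has_dim (K : fieldType) (V : lmodType K) (n : nat) : Prop :=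
  exists b : 'I_n -> V,
    forall v : V, exists! c : {ffun 'I_n -> K}, v = \sum_i c i *: b i.

Definition has_rank (M : nmodType) (n : nat) : Prop :=
  has_dim (rat_tensor (grothendieck_group M)) n.

(** * Monoid algebras

   The ring structure that the library puts on [{malg R[M]}] is restricted to
   monoids in which only the identity is invertible, and to multiplicative
   notation; here [M] is an arbitrary additive commutative monoid. *)

Definition monoid_algebra (R : comNzRingType) (M : nmodType) : Type :=
  {malg R[M]}.

Section MonoidAlgebra.

Variables (R : comNzRingType) (M : nmodType).
Local Notation RM := (monoid_algebra R M).
Implicit Types (f g h : {malg R[M]}) (a b : M).

HB.instance Definition _ := GRing.Lmodule.copy RM {malg R[M]}.

Definition ma_one : {malg R[M]} := << 0 >>.

Definition ma_mul f g : {malg R[M]} :=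
  \sum_(a <- msupp f) \sum_(b <- msupp g) << f@_a * g@_b *g a + b >>.

Lemma ma_mulw (d d' : {fset M}) f g : msupp f `<=` d -> msupp g `<=` d' ->
  ma_mul f g = \sum_(a <- d) \sum_(b <- d') << f@_a * g@_b *g a + b >>.
Proof.
move=> sub sub'; rewrite /ma_mul (big_fset_incl _ sub) /=.
  apply: eq_bigr => a _; apply: big_fset_incl => // b _ /mcoeff_outdom ->.
  by rewrite mulr0 monalgU0.
move=> a _ /mcoeff_outdom fa.
by rewrite big1 // => b _; rewrite fa mul0r monalgU0.
Qed.

Lemma ma_mulUU (x y : R) a b :
  ma_mul << x *g a >> << y *g b >> = << x * y *g a + b >>.
Proof. by rewrite (ma_mulw msuppU_le msuppU_le) !big_seq_fset1 !mcoeffUU. Qed.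

Lemma ma_mulC : commutative ma_mul.
Proof.
move=> f g; rewrite /ma_mul exchange_big; apply: eq_bigr => b _ /=.
by apply: eq_bigr => a _; rewrite mulrC addrC.
Qed.

Lemma ma_mulDl : left_distributive ma_mul +%R.
Proof.
move=> f g h; have subh := fsubset_refl (msupp h).
rewrite (ma_mulw (msuppD_le f g) subh).
rewrite (ma_mulw (fsubsetUl _ (msupp g)) subh).
rewrite (ma_mulw (fsubsetUr (msupp f) _) subh).
rewrite -big_split /=; apply: eq_bigr => a _.
rewrite -big_split /=; apply: eq_bigr => b _.
by rewrite mcoeffD mulrDl monalgUD.
Qed.

Lemma ma_mulDr : right_distributive ma_mul +%R.
Proof. by move=> f g h; rewrite ma_mulC ma_mulDl !(ma_mulC f). Qed.

Lemma ma_mul0l : left_zero 0 ma_mul.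
Proof. by move=> f; rewrite /ma_mul msupp0 big_seq_fset0. Qed.

Lemma ma_mul0r : right_zero 0 ma_mul.
Proof. by move=> f; rewrite ma_mulC ma_mul0l. Qed.

Lemma ma_mulA : associative ma_mul.
Proof.
have sl f h : ma_mul f h = \sum_(a <- msupp f) ma_mul << f@_a *g a >> h.
  rewrite {1}[f]monalgE.
  exact: (big_morph (ma_mul^~ h) (fun x y => ma_mulDl x y h) (ma_mul0l h)).
have sr f h : ma_mul h f = \sum_(a <- msupp f) ma_mul h << f@_a *g a >>.
  by rewrite ma_mulC sl; apply: eq_bigr => a _; rewrite ma_mulC.
have suml h I (r : seq I) (F : I -> {malg R[M]}) :
    ma_mul (\sum_(i <- r) F i) h = \sum_(i <- r) ma_mul (F i) h.
  exact: (big_morph (ma_mul^~ h) (fun x y => ma_mulDl x y h) (ma_mul0l h)).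
have sumr h I (r : seq I) (F : I -> {malg R[M]}) :
    ma_mul h (\sum_(i <- r) F i) = \sum_(i <- r) ma_mul h (F i).
  exact: (big_morph (ma_mul h) (ma_mulDr h) (ma_mul0r h)).
move=> f g h; rewrite [LHS]sl (sl f g) suml; apply: eq_bigr => a _.
rewrite (sl g h) sumr (sr g) suml; apply: eq_bigr => b _.
rewrite (sr h) sumr (sr h); apply: eq_bigr => c _.
by rewrite !ma_mulUU mulrA addrA.
Qed.

Lemma ma_mul1l : left_id ma_one ma_mul.
Proof.
move=> f; rewrite (ma_mulw msuppU_le (fsubset_refl _)) big_seq_fset1.
rewrite [RHS]monalgE; apply: eq_bigr => a _.
by rewrite mcoeffUU mul1r add0r.
Qed.

Lemma ma_one_neq0 : ma_one != 0.
Proof. by rewrite monalgU_eq0 oner_eq0. Qed.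

HB.instance Definition _ := GRing.Zmodule_isComNzRing.Build RM
  ma_mulA ma_mulC ma_mul1l ma_mulDl ma_one_neq0.

End MonoidAlgebra.

(* Main.v *)
(* Put q = p + 1 and let M consist of the rationals k / d >= 0, with d a power of
   p, such that q | k or k / d > q.  Finitely many nonzero elements of M always
   have a common divisor q / p^n, so an MCD of a finite set belongs to that set
   and is its least element: M is a q-GCD monoid.

   In F_p[M] put R_n = x^(q+1) + ... + x^(q+n) and D_n = x^n - 1 for n = q, p^2.
   Then R_(p^2) D_q = R_q D_(p^2), so R_(p^2) and R_q are both MCDs of
   {R_(p^2) D_q, R_(p^2) R_q} once (D_q, R_q) and (D_(p^2), R_(p^2)) are coprime.
   They are not associates since their values at x = 1 are 0 and 1.  Let c be a
   common divisor, a polynomial in z = x^(1/N) with N a large power of p.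
   - If c | D_q, its exponents are at most qN, so c is a polynomial in w = z^q
     dividing w^N - 1 = (w - 1)^N; and c(1) <> 0 as R_q(1) <> 0, so c is constant.
   - If c | D_(p^2) = (z - 1)^(p^2 N), then c ~ (z - 1)^i, and c | R_(p^2) gives
     i < p^2 N.  If i > 0, let r be the p-part of i; the coefficient of z^r in c
     is nonzero, but r / N is not in M, since r is prime to q and r <= pN < qN. *)

Require Import Defs.
From mathcomp Require Import all_boot all_order all_algebra.
From HB Require Import structures.
From mathcomp Require Import finmap boolp monalg zify ring.

Set Implicit Arguments.
Unset Strict Implicit.
Unset Printing Implicit Defensive.

Import Order.TTheory GRing.Theory Num.Theory.
Local Open Scope ring_scope.

(** * Rank 1 from commensurability of the elements *)

Lemma lin_of0 (R : nzRingType) (A : nmodType) : lin_of R (0 : A) = 0.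
Proof.
by apply: (addrI (lin_of R (0 : A))); rewrite -lin_ofD !addr0.
Qed.

Lemma lin_ofMn (R : nzRingType) (A : nmodType) n :
  {morph @lin_of R A : a / a *+ n}.
Proof.
by move=> a; elim: n => [|n IH]; rewrite ?mulr0n ?lin_of0 // !mulrS lin_ofD IH.
Qed.

Lemma lin_ofN (R : nzRingType) (A : zmodType) : {morph @lin_of R A : a / - a}.
Proof.
by move=> a; apply: (addrI (lin_of R a)); rewrite -lin_ofD !subrr lin_of0.
Qed.

Lemma mulrn_scale (V : lmodType rat) (u v : V) n m : (0 < n)%N ->
  u *+ n = v *+ m -> u = (m%:R / n%:R) *: v.
Proof.
move=> n0 E; have n0' : n%:R != 0 :> rat by rewrite pnatr_eq0 -lt0n.
by apply: (scalerI n0'); rewrite scalerA mulrC divfK // !scaler_nat.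
Qed.

Lemma mulrz_scale (V : lmodType rat) (u v : V) (c : rat) (k : int) :
  u = c *: v -> u *~ k = (k%:~R * c) *: v.
Proof. by move=> ->; rewrite -scaler_int scalerA. Qed.

Lemma lin_ofMz (R : nzRingType) (A : zmodType) (k : int) :
  {morph @lin_of R A : a / a *~ k}.
Proof. by case: k => n a; rewrite ?NegzE ?mulrNz ?lin_ofN lin_ofMn. Qed.

Lemma lin_int_scale (A : nmodType) (x : linearization int A) (k : int) :
  k *: x = x *~ k.
Proof. by rewrite -{1}[k]intz scaler_int. Qed.

Lemma lin_of_lin_ofMn (M : nmodType) n (a : M) :
  lin_of rat (lin_of int (a *+ n) : grothendieck_group M) =
  lin_of rat (lin_of int a : grothendieck_group M) *+ n
    :> rat_tensor (grothendieck_group M).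
Proof.
have E := congr1 (@lin_of rat (grothendieck_group M)) (lin_ofMn int n a).
have E2 := @lin_ofMn rat (grothendieck_group M) n (lin_of int a).
exact: etrans E E2.
Qed.

(** Every generator is a rational multiple of the class [L b], which therefore spans. Extending [f]
    through the two universal properties gives a linear form [h] with [h (L b) = f b], nonzero, so
    the coefficient of [L b] is unique. *)
Lemma has_rank1 (M : nmodType) (f : {additive M -> rat}) (b : M) :
    f b != 0 ->
    (forall a, exists n m, (0 < n)%N /\ a *+ n = b *+ m) ->
  has_rank M 1.
Proof.
move=> fb0 comm.
have [g gE _] := @linearization_universal int M (zmodule rat) f.
have [h hE _] := @linearization_universal rat (grothendieck_group M) rat^o g.
pose L a : rat_tensor (grothendieck_group M) := lin_of rat (lin_of int a).
have span (v : rat_tensor (grothendieck_group M)) : exists c : rat, v = c *: L b.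
  (* Generators come in two layers: rational combinations of classes of [k], then integer
     combinations of classes of [a], to which [comm] applies. *)
  elim/quotW: v => x; rewrite lin_piE.
  apply: (big_ind (fun v => exists c : rat, v = c *: L b)).
  - by exists 0; rewrite scale0r.
  - by move=> _ _ [c ->] [c' ->]; exists (c + c'); rewrite scalerDl.
  move=> k _; suff [c ->] : exists c : rat, lin_of rat k = c *: L b.
    by exists (x@_k * c); rewrite scalerA.
  elim/quotW: k => y; rewrite lin_piE.
  apply: (big_ind (fun k => exists c : rat, lin_of rat k = c *: L b)).
  - by exists 0; rewrite lin_of0 scale0r.
  - by move=> k k' [c E] [c' E']; exists (c + c'); rewrite lin_ofD E E' scalerDl.
  move=> a _; have [n [m [n0 E0]]] := comm a.
  have LMn l a' : L (a' *+ l) = L a' *+ l.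
    exact: lin_of_lin_ofMn.
  have E : L a *+ n = L b *+ m.
    exact: etrans (esym (LMn n a)) (etrans (congr1 L E0) (LMn m b)).
  exists ((y@_a)%:~R * (m%:R / n%:R)).
  have {}E := mulrz_scale (y@_a) (mulrn_scale n0 E).
  rewrite -E lin_int_scale; exact: lin_ofMz.
exists (fun=> L b) => v; have [c ->] := span v.
exists [ffun=> c]; split=> [|c']; first by rewrite big_ord1 ffunE.
have hZ u : h (u *: L b) = u * f b.
  have hL : h (L b) = f b := etrans (hE _) (gE b).
  by transitivity (u * h (L b)); [apply: linearZ | rewrite hL].
rewrite big_ord1 => E; have {E} := etrans (esym (hZ _)) (etrans (congr1 h E) (hZ _)).
move=> /(mulIf fb0) ->.
by apply/ffunP => i; rewrite ffunE (ord1 i).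
Qed.

(** * The exponent monoid and its q-GCD property *)

Section Exponents.
Variables p q : nat.

(** The fraction [k / d] need not be in lowest terms, so sums can use the denominator [d * d'];
    taking [k] in [nat] makes [x] nonnegative. *)
Definition exponents : {pred rat} := fun x =>
  `[< exists d k : nat,
        [/\ p.-nat d, x * d%:R = k%:R & (q %| k)%N || (q * d < k)%N] >].

(** If [q] divides both numerators, it divides that of the sum; otherwise one summand exceeds [q],
    and adding a nonnegative number keeps it there. *)
Lemma exponents_closed : addr_closed exponents.
Proof.
split; first by apply/asboolP; exists 1, 0; rewrite mul0r dvdn0.
move=> x y /asboolP[d [k [pd xE xP]]] /asboolP[d' [k' [pd' yE yP]]].
apply/asboolP; exists (d * d')%N, (k * d' + k' * d)%N; split.
- by rewrite pnatM pd.
- by rewrite natrD !natrM -xE -yE; ring.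
have [d0 d'0] : (0 < d)%N /\ (0 < d')%N by case/andP: pd; case/andP: pd'.
case/orP: xP => xP; first case/orP: yP => yP.
- by rewrite dvdn_add ?dvdn_mulr.
- by apply/orP; right; nia.
- by apply/orP; right; nia.
Qed.

Record expmon := ExpMon { expval : rat; expvalP : exponents expval }.
HB.instance Definition _ := [isSub for expval].
HB.instance Definition _ := [Choice of expmon by <:].
HB.instance Definition _ :=
  GRing.SubChoice_isSubNmodule.Build rat exponents expmon exponents_closed.

Lemma expvalD : {morph expval : a b / a + b}.
Proof. exact: (raddfD (val : expmon -> rat)). Qed.
Lemma expval0 : expval 0 = 0.
Proof. exact: (raddf0 (val : expmon -> rat)). Qed.
Lemma exponent_nat k : (q %| k)%N || (q < k)%N -> k%:R \in exponents.
Proof. by move=> kP; apply/asboolP; exists 1, k; rewrite mulr1 muln1. Qed.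

Definition exp_nat k (kP : (q %| k)%N || (q < k)%N) : expmon :=
  ExpMon (exponent_nat kP).

Lemma expvalE (a : expmon) : exists d k : nat,
  [/\ p.-nat d, expval a * d%:R = k%:R & (q %| k)%N || (q * d < k)%N].
Proof. by apply/asboolP; case: a. Qed.

Lemma expval_inj : injective expval.
Proof. exact: val_inj. Qed.

Lemma expval_ge0 a : 0 <= expval a.
Proof.
have [d [k [/andP[d0 _] E _]]] := expvalE a.
by rewrite -(@pmulr_lge0 _ d%:R) ?ltr0n // E ler0n.
Qed.

Lemma expmon_cancellative : cancellative expmon.
Proof.
by move=> a b c /(congr1 expval); rewrite !expvalD => /addrI/expval_inj.
Qed.

Lemma expvalMn n : {morph expval : a / a *+ n}.
Proof. exact: (raddfMn (val : expmon -> rat)). Qed.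

Lemma expmon_torsion_free : torsion_free expmon.
Proof.
move=> n b c n0 /(congr1 expval); rewrite !expvalMn => /eqP.
by rewrite eqr_pMn2r // => /eqP/expval_inj.
Qed.

Lemma expmon_rank1 : (0 < q)%N -> has_rank expmon 1.
Proof.
move=> q0; have qP : (q %| q)%N || (q < q)%N by rewrite dvdnn.
pose f : {additive expmon -> rat} := (val : expmon -> rat).
apply: (@has_rank1 _ f (exp_nat qP)) => [|a].
  by rewrite /= pnatr_eq0 -lt0n.
have [d [k [/andP[d0 _] E _]]] := expvalE a.
exists (q * d)%N, k; split; first by rewrite muln_gt0 q0.
apply: expval_inj; rewrite !expvalMn -mulr_natr natrM [q%:R * _]mulrC mulrA E.
by rewrite mulr_natl.
Qed.

Lemma expmon_divides (a b : expmon) (d k : nat) : p.-nat d ->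
    (expval b - expval a) * d%:R = k%:R -> (q %| k)%N || (q * d < k)%N ->
  divides (+%R : Monoid.com_law (0 : expmon)) predT a b.
Proof.
move=> pd E kP; have cP : expval b - expval a \in exponents.
  by apply/asboolP; exists d, k.
exists (ExpMon cP) => //; apply: expval_inj.
by rewrite expvalD /= addrC subrK.
Qed.

Hypotheses (p_prime : prime p) (q_gt0 : (0 < q)%N).

Lemma small_exponent n : q%:R / (p ^ n)%:R \in exponents.
Proof.
apply/asboolP; exists (p ^ n)%N, q; split; rewrite ?dvdnn //.
  by rewrite pnatX pnat_id.
by rewrite divfK // pnatr_eq0 expn_eq0 negb_and -lt0n prime_gt0.
Qed.

Definition small n : expmon := ExpMon (small_exponent n).

Lemma small_divides a : a != 0 -> exists N : nat, forall n, (N <= n)%N ->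
  divides (+%R : Monoid.com_law (0 : expmon)) predT (small n) a.
Proof.
move=> a0; have [d [k [pd E kP]]] := expvalE a.
have d0 : (0 < d)%N by case/andP: pd.
have k0 : (0 < k)%N.
  rewrite lt0n; apply: contraNneq a0 => k0; move: E.
  rewrite k0 => /eqP; rewrite mulf_eq0 pnatr_eq0 gtn_eqF // orbF => /eqP a0.
  by apply/eqP/expval_inj; rewrite a0 expval0.
(* Since [n < p ^ n], this bound gives [q * d < p ^ n]. If [k > q * d], then [k * p ^ n - q * d >= q
   * d * p ^ n + p ^ n - q * d], which exceeds [q * d * p ^ n]. *)
exists (q * d)%N => n Nn.
have lt_pn : (q * d < p ^ n)%N by apply: leq_ltn_trans Nn (ltn_expl _ (prime_gt1 p_prime)).
have pn0 : (p ^ n)%:R != 0 :> rat by rewrite pnatr_eq0; lia.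
apply: (@expmon_divides _ _ (d * p ^ n)%N (k * p ^ n - q * d)%N).
- by rewrite pnatM pd pnatX pnat_id.
- rewrite /= natrB ?natrM; last by nia.
  by rewrite -E; field.
case/orP: kP => kP; first by rewrite dvdn_sub ?dvdn_mulr.
by apply/orP; right; nia.
Qed.

Lemma mcd_mem (s : seq expmon) (d : expmon) :
  is_MCD (+%R : Monoid.com_law (0 : expmon)) predT (fun x => x \in s) d ->
  d \in s.
Proof.
move=> [[_ d_div] d_max]; apply: contraT => ds.
have [N NP] : exists N : nat, forall n, (N <= n)%N -> forall x y : expmon,
    x \in s -> x = d + y ->
    divides (+%R : Monoid.com_law (0 : expmon)) predT (small n) y.
  elim: s ds {d_div d_max} => [|x s IH]; first by exists 0.
  rewrite inE negb_or => /andP[dx /IH[N NP]].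
  (* The induction forgets that [d] divides all of [s]; an element that is not a multiple of [d]
     satisfies the claim vacuously. *)
  have [[y xE]|nodiv] := pselect (exists y, x = d + y).
    have y0 : y != 0 by apply: contraNneq dx => y0; rewrite xE y0 addr0.
    have [N' N'P] := small_divides y0.
    exists (maxn N N') => n; rewrite geq_max => /andP[Nn N'n] x' y'.
    rewrite inE => /orP[/eqP -> /[1!xE]/expmon_cancellative <-|]; first exact: N'P.
    exact: NP.
  exists N => n Nn x' y'; rewrite inE => /orP[/eqP -> E|]; last exact: NP.
  by case: nodiv; exists y'.
have /d_max[_ [v _ /(congr1 expval)]] : common_divisor
    (+%R : Monoid.com_law (0 : expmon)) predT
    (quotients (+%R : Monoid.com_law (0 : expmon)) predT (fun x => x \in s) d)
    (small N).
  by split=> // y [_ [x xs xE]]; apply: NP xs xE.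
rewrite [LHS]expvalD expval0 => /eqP; rewrite paddr_eq0 ?expval_ge0 //.
rewrite /= mulf_eq0 invr_eq0 !pnatr_eq0 expn_eq0.
by rewrite (gtn_eqF q_gt0) (gtn_eqF (prime_gt0 p_prime)).
Qed.

(** Two MCDs of [s] both lie in [s], so each divides the other; exponents being nonnegative, they
    are equal. *)
Lemma expmon_qGCD : q_GCD_monoid expmon.
Proof.
move=> s _ _ d d' dM d'M.
have [ds d's] := (mcd_mem dM, mcd_mem d'M).
have [y _ d'E] := dM.1.2 _ d's; have [y' _ dE] := d'M.1.2 _ ds.
suff -> : d' = d.
  by exists 0; rewrite /= ?addr0 //; split=> //; exists 0; rewrite //= addr0.
apply: expval_inj; apply/le_anti.
by apply/andP; split; [rewrite dE | rewrite d'E];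
  rewrite expvalD ler_wpDr ?expval_ge0.
Qed.

End Exponents.

(** * Factors of ['X^n - 1] with restricted support in characteristic [p] *)

Section PolynomialFactors.

Variables (F : fieldType) (p : nat).
Hypothesis pF : p \in [pchar F].
Implicit Types c e f : {poly F}.

Lemma pnat_pchar_poly N : p.-nat N -> [pchar {poly F}].-nat N.
Proof.
move=> pN; apply: sub_in_pnat pN => r _ /eqP ->.
by rewrite pchar_poly.
Qed.

Lemma subX1_exp f N : p.-nat N -> (f - 1) ^+ N = f ^+ N - 1.
Proof.
move=> /pnat_pchar_poly pN.
by rewrite exprDn_pchar // exprNn_pchar // expr1n.
Qed.

Definition support_in (P : pred nat) f := forall k, f`_k != 0 -> P k.

Lemma comp_poly_XnK q f : (0 < q)%N -> support_in (fun k => q %| k)%N f ->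
  (\poly_(i < size f) f`_(i * q)) \Po 'X^q = f.
Proof.
move=> q0 fq; apply/polyP => i; rewrite coef_comp_poly_Xn // coef_poly.
case: ifPn => qi; last by apply/esym/eqP; apply: contraNT qi => /fq.
rewrite divnK //; case: ltnP => // le_fi.
by rewrite nth_default // (leq_trans le_fi) ?leq_div.
Qed.

Lemma comp_poly_Xn_inj q : (0 < q)%N -> injective (fun f => f \Po 'X^q).
Proof.
move=> q0 f g /polyP E; apply/polyP => i.
by have := E (i * q)%N; rewrite !coef_comp_poly_Xn // dvdn_mull // mulnK.
Qed.

Lemma size_factor_subX1_mul q N c e :
    (0 < q)%N -> p.-nat N ->
    c * e = 'X^(q * N) - 1 ->
    support_in (fun k => (q %| k) || (q * N < k))%N c ->
    support_in (fun k => (q %| k) || (q * N < k))%N e ->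
    c.[1] != 0 ->
  size c = 1%N.
Proof.
move=> q0 pN ce cM eM c1; have N0 : (0 < N)%N by case/andP: pN.
have ce_size : size (c * e) = (q * N).+1 by rewrite ce size_XnsubC ?muln_gt0 ?q0.
have ce0 : c * e != 0 by rewrite -size_poly_gt0 ce_size.
have [c0 e0] : c != 0 /\ e != 0 by apply/andP; rewrite -negb_or -mulf_eq0.
(* Both factors have degree at most [q * N], so only exponents divisible by [q] survive. *)
have sM f : (size f <= (q * N).+1)%N ->
    support_in (fun k => (q %| k) || (q * N < k))%N f ->
    support_in (fun k => q %| k)%N f.
  move=> sf fM k fk; case/orP: (fM k fk) => // lt_k.
  by rewrite nth_default ?eqxx // in fk; apply: leq_trans lt_k.
have := size_mul c0 e0; rewrite ce_size => sE.
have [sc se] : (0 < size c)%N /\ (0 < size e)%N by rewrite !size_poly_gt0.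
have [sc' se'] : (size c <= (q * N).+1)%N /\ (size e <= (q * N).+1)%N.
  by move: (size c) (size e) (q * N)%N sE sc se => sc se n; lia.
have cq := comp_poly_XnK q0 (sM c sc' cM).
have eq := comp_poly_XnK q0 (sM e se' eM).
set c' := (\poly_(i < size c) _) in cq; set e' := (\poly_(i < size e) _) in eq.
(* As [c] and [e] are both polynomials in ['X^q], the factorization descends along this injective
   substitution, and Frobenius turns ['X^N - 1] into a power of ['X - 1]. *)
have : c' * e' = ('X - 1%:P) ^+ N.
  apply: (comp_poly_Xn_inj q0); rewrite subX1_exp // comp_polyM cq eq ce.
  by rewrite comp_polyB comp_polyC comp_Xn_poly -exprM.
move=> /(congr1 (fun f => c' %| f)); rewrite dvdp_mulr ?dvdpp // => /esym.
case/dvdp_exp_XsubCP => k _ /eqpP[[a b] /= /andP[a0 b0]] c'E.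
have c'1 : c'.[1] != 0.
  by move: c1; rewrite -{1}cq horner_comp hornerXn expr1n.
have k0 : k = 0.
  apply/eqP; move/(congr1 (fun f => f.[1])): c'E; rewrite !hornerE => /eqP.
  rewrite subrr expr0n; case: (k == 0)%N => //.
  by rewrite mulr0 mulf_eq0 (negPf a0) (negPf c'1).
have : size (a *: c') == 1%N by rewrite c'E k0 expr0 alg_polyC size_polyC b0.
rewrite size_scale // => /size_poly1P[u u0 c'u].
by rewrite -cq c'u comp_polyC size_polyC u0.
Qed.

Lemma coef1_exp_subX1 n : (('X - 1) ^+ n : {poly F})`_1 = n%:R * (-1) ^+ n.-1.
Proof.
have := coef_deriv (('X - 1) ^+ n : {poly F}) 0; rewrite mulr1n => <-.
rewrite deriv_exp derivB derivX derivC subr0 mul1r.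
rewrite coefMn -horner_coef0 horner_exp !hornerE. by rewrite mulr_natl.
Qed.

(** With [r] the p-part of [n] and [n = r * m], Frobenius gives [('X^r - 1) ^+ m], whose coefficient
    at [r] is [m] up to sign, nonzero because [p] does not divide [m]. *)
Lemma coef_exp_subX1_part n : (0 < n)%N ->
  (('X - 1) ^+ n : {poly F})`_(n`_p) != 0.
Proof.
move=> n0; rewrite -{1}(partnC p n0) exprM subX1_exp ?part_pnat //.
have -> : 'X^(n`_p) - 1 = ('X - 1) \Po 'X^(n`_p) :> {poly F}.
  by rewrite comp_polyB comp_polyC comp_polyX.
rewrite -(rmorphXn (comp_poly 'X^(n`_p))) /= coef_comp_poly_Xn ?part_gt0 //.
rewrite dvdnn divnn part_gt0 coef1_exp_subX1 mulf_neq0 ?expf_neq0 ?oppr_eq0 ?oner_eq0 //.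
by rewrite -(dvdn_pcharf pF) -p'natE ?(pcharf_prime pF) ?part_pnat.
Qed.

Lemma size_factor_subX1_sub q N m c e e' :
    (p < q)%N -> coprime p q -> p.-nat N ->
    c * e = 'X^(p ^ 2 * N) - 1 ->
    c * e' * ('X^N - 1) = 'X^m * ('X^(p ^ 2 * N) - 1) ->
    support_in (fun k => (q %| k) || (q * N < k))%N c ->
  size c = 1%N.
Proof.
move=> pq pq1 pN ce ce' cM; have p_pr := pcharf_prime pF.
have p2N : p.-nat (p ^ 2 * N)%N by rewrite pnatM pnatX pnat_id.
have N0 : (0 < N)%N by case/andP: pN.
have p0 := prime_gt0 p_pr.
have : c %| ('X - 1%:P) ^+ (p ^ 2 * N) by rewrite subX1_exp // -ce dvdp_mulr.
case/dvdp_exp_XsubCP => i i_le c_eqp.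
(* Multiplying by ['X^N - 1], which is [('X - 1) ^+ N], shows that [('X - 1) ^+ (i + N)] divides
   ['X^m * ('X - 1) ^+ (p ^ 2 * N)]; the factor ['X^m] is coprime to ['X - 1]. *)
have i_lt : (i + N <= p ^ 2 * N)%N.
  rewrite -(@dvdp_Pexp2l F ('X - 1%:P)) ?size_XsubC //.
  rewrite -(@Gauss_dvdpr _ _ ('X^m)); last first.
    by rewrite coprimep_expl // coprimep_expr // coprimep_sym coprimep_XsubC rootX oner_eq0.
  rewrite exprD -(eqp_dvdl _ (eqp_mulr _ c_eqp)) !subX1_exp // -ce'.
  by rewrite mulrAC dvdp_mulr.
have [i0|i_gt0] := posnP i.
  by apply/eqP; rewrite size_poly_eq1 (eqp_trans c_eqp) // i0 expr0 eqpxx.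
have /cM : c`_(i`_p) != 0.
  have /eqpP[[a b] /= /andP[a0 b0] E] := c_eqp.
  have : (a *: c)`_(i`_p) != 0 by rewrite E coefZ mulf_neq0 // coef_exp_subX1_part.
  by rewrite coefZ mulf_eq0 negb_or => /andP[].
have [j ij] := p_natP (part_pnat p i).
case/orP => [q_dvd|].
  suff : coprime q (i`_p) by rewrite /coprime (gcdn_idPl q_dvd); have := prime_gt0 p_pr; lia.
  by rewrite ij coprimeXr // coprime_sym.
have [n Nn] := p_natP pN.
(* A power of [p] below [p ^ 2 * N = p ^ n.+2] is at most [p * N], hence less than [q * N]. *)
have : (i`_p < p ^ (n.+2))%N.
  apply: leq_ltn_trans (dvdn_leq i_gt0 (dvdn_part _ _)) _.
  by rewrite -addn2 expnD mulnC -Nn; lia.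
rewrite ij ltn_exp2l ?prime_gt1 // ltnS => jn.
have := leq_pexp2l p0 jn; rewrite expnS -Nn; nia.
Qed.

End PolynomialFactors.

(** * From the monoid algebra to polynomials in [x^(1/N)] *)

Section Spread.


Variables (F : fieldType) (p q : nat).
Hypotheses (p_prime : prime p) (pq1 : coprime p q).
Local Notation M := (expmon p q).
Local Notation FM := (monoid_algebra F M).
Implicit Types (a b : M) (f g c : {malg F[M]}) (N : nat).

Definition integral_at N a := expval a * N%:R \is a Num.nat.
(** Truncation makes this total; it is the exact product only under [integral_at N a]. *)
Definition degree_at N a := Num.truncn (expval a * N%:R).
Definition supported_at N f := forall a, a \in msupp f -> integral_at N a.

Lemma degree_atK N a : integral_at N a -> (degree_at N a)%:R = expval a * N%:R.
Proof. exact: truncnK. Qed.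

Lemma degree_atD N a b : integral_at N a -> integral_at N b ->
  degree_at N (a + b) = (degree_at N a + degree_at N b)%N.
Proof.
move=> aN bN; rewrite /degree_at expvalD mulrDl truncnD //.
by rewrite nnegrE natr_ge0.
Qed.

Lemma degree_at_inj N : (0 < N)%N -> {in integral_at N &, injective (degree_at N)}.
Proof.
move=> N0 a b aN bN ab; apply: expval_inj; apply: (@mulIf _ N%:R).
  by rewrite pnatr_eq0 -lt0n.
by rewrite -(degree_atK aN) -(degree_atK bN) ab.
Qed.

Lemma degree_at0 N : degree_at N 0 = 0%N.
Proof. by rewrite /degree_at expval0 mul0r truncn0. Qed.

Lemma integral_at0 N : integral_at N 0.
Proof. by rewrite /integral_at expval0 mul0r rpred0. Qed.

(** The denominator [d] witnessing membership may differ from [N]. Cross-multiplying compares the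
    two numerators, and [d], a power of [p], is prime to [q]. *)
Lemma degree_at_cond N a : p.-nat N -> integral_at N a ->
  (q %| degree_at N a)%N || (q * N < degree_at N a)%N.
Proof.
move=> pN aN; have [d [k [pd E kP]]] := expvalE a.
have [N0 d0] : (0 < N)%N /\ (0 < d)%N by case/andP: pN; case/andP: pd.
have {}E : (degree_at N a * d = k * N)%N.
  by apply/eqP; rewrite -(eqr_nat rat) !natrM degree_atK // mulrAC E.
case/orP: kP => kP; apply/orP; [left | right; nia].
rewrite -(@Gauss_dvdl q _ d) ?E ?dvdn_mulr //.
have [j ->] := p_natP pd; by rewrite coprimeXr // coprime_sym.
Qed.

Lemma integral_at_pow (s : seq M) : exists n, forall a, a \in s -> integral_at (p ^ n) a.
Proof.
suff [n nP] : exists n, forall n', (n <= n')%N ->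
    forall a, a \in s -> integral_at (p ^ n') a by exists n; apply: nP.
elim: s => [|a s [n IH]]; first by exists 0%N.
have [d [k [/p_natP[j ->] E _]]] := expvalE a.
exists (maxn n j) => n'; rewrite geq_max => /andP[nn jn] b.
rewrite inE => /orP[/eqP -> |]; last exact: IH.
by rewrite /integral_at -(subnKC jn) expnD natrM mulrA E -natrM natr_nat.
Qed.

(* For [f] supported at [N], this is [f] read as a polynomial in [x^(1/N)]. *)
Definition spread N f : {poly F} :=
  \sum_(a <- msupp f) f@_a *: 'X^(degree_at N a).

Lemma spread_sub N f (d : {fset M}) : (msupp f `<=` d)%fset ->
  spread N f = \sum_(a <- d) f@_a *: 'X^(degree_at N a).
Proof.
move=> sub; apply: big_fset_incl => // a _ /mcoeff_outdom ->.
by rewrite scale0r.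
Qed.

Lemma spreadD N : {morph spread N : f g / f + g}.
Proof.
move=> f g; rewrite (spread_sub N (msuppD_le f g)).
rewrite (spread_sub N (fsubsetUl _ (msupp g))) (spread_sub N (fsubsetUr (msupp f) _)).
by rewrite -big_split; apply: eq_bigr => a _ /=; rewrite mcoeffD scalerDl.
Qed.

Lemma spread0 N : spread N 0 = 0.
Proof. by rewrite /spread msupp0 big_seq_fset0. Qed.

Lemma spreadB N : {morph spread N : f g / f - g}.
Proof.
by move=> f g; rewrite -[f in RHS](subrK g) [in RHS]spreadD addrK.
Qed.

Lemma spread_sum N I (r : seq I) (P : pred I) (E : I -> {malg F[M]}) :
  spread N (\sum_(i <- r | P i) E i) = \sum_(i <- r | P i) spread N (E i).
Proof. exact: (big_morph _ (spreadD N) (spread0 N)). Qed.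

Lemma spreadU N (u : F) a : spread N << u *g a >> = u *: 'X^(degree_at N a).
Proof. by rewrite (spread_sub N msuppU_le) big_seq_fset1 mcoeffUU. Qed.

Lemma spreadM N f g : supported_at N f -> supported_at N g ->
  spread N ((f : FM) * (g : FM) : FM) = spread N f * spread N g.
Proof.
move=> fN gN; rewrite [LHS](_ : _ = spread N (ma_mul f g)) // /ma_mul spread_sum.
rewrite [spread N f]/spread mulr_suml; apply: eq_big_seq => a /fN aN.
rewrite spread_sum [spread N g]/spread mulr_sumr; apply: eq_big_seq => b /gN bN.
by rewrite spreadU degree_atD // exprD -scalerAl -scalerAr scalerA.
Qed.

Lemma coef_spread N f k :
  (spread N f)`_k = \sum_(a <- msupp f | degree_at N a == k) f@_a.
Proof. exact: coef_sumMXn. Qed.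

Lemma coef_spread_degree N f a : (0 < N)%N -> supported_at N f -> a \in msupp f ->
  (spread N f)`_(degree_at N a) = f@_a.
Proof.
move=> N0 fN af; rewrite coef_spread big_mkcond (bigD1_seq a) ?fset_uniq //= eqxx.
rewrite big1_seq ?addr0 // => b /andP[ba bf]; case: eqP => // E.
by case/eqP: ba; apply: (degree_at_inj N0); [exact: fN | exact: fN | ].
Qed.

Lemma spread_support N f : p.-nat N -> supported_at N f ->
  support_in (fun k => (q %| k) || (q * N < k))%N (spread N f).
Proof.
move=> pN fN k; apply: contraNT => kP; rewrite coef_spread big_seq_cond big_pred0 //.
move=> a; apply: contraNF kP => /andP[/fN aN /eqP <-]; exact: degree_at_cond.
Qed.

(** Distinct exponents in the support keep distinct degrees, so no terms merge: a constant image
    leaves only the exponent 0, with an invertible coefficient. *)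
Lemma unit_of_size_spread N f : (0 < N)%N -> supported_at N f ->
    size (spread N f) = 1%N ->
  is_unit ( *%R : Monoid.com_law (1 : FM)) [pred x | x != 0] (f : FM).
Proof.
move=> N0 fN /eqP/size_poly1P[u u0 fu].
have {}fN a : a \in msupp f -> a = 0.
  move=> af; apply: (degree_at_inj N0); [exact: fN | exact: integral_at0 |].
  rewrite degree_at0; apply/eqP; have := af; rewrite -mcoeff_neq0.
  rewrite -(coef_spread_degree N0 fN af) fu coefC.
  by case: (degree_at N a == 0)%N; rewrite ?eqxx.
have fE : f = << f@_0 *g 0 >>.
  apply/malgP => a; rewrite mcoeffU; case: eqP => [<-|a0]; first by rewrite mulr1n.
  by rewrite mulr0n mcoeff_outdom //; apply/negP => /fN /esym.
have f0 : f@_0 != 0.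
  apply: contraNneq u0 => f0; move: fu; rewrite fE f0 monalgU0 spread0 => /esym/eqP.
  by rewrite polyC_eq0.
split; first by rewrite inE fE monalgU_eq0.
exists (<< (f@_0)^-1 *g 0 >> : {malg F[M]}); first by rewrite inE monalgU_eq0 invr_eq0.
rewrite [LHS](_ : _ = ma_mul f << (f@_0)^-1 *g 0 >>) //.
by rewrite fE ma_mulUU mcoeffUU mulfV // addr0.
Qed.

(** At a common [N], [spread] is multiplicative and sends nonzero elements to nonzero ones, which
    reduces the claim to polynomials over a field. *)
Lemma monoid_algebra_mulf_neq0 (f g : FM) : f != 0 -> g != 0 -> f * g != 0.
Proof.
have [n nP] := integral_at_pow (msupp f ++ msupp g).
have [fN gN] : supported_at (p ^ n) f /\ supported_at (p ^ n) g.
  by split=> a af; apply: nP; rewrite mem_cat af ?orbT.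
have n0 : (0 < p ^ n)%N by rewrite expn_gt0 prime_gt0.
have spread_neq0 h : supported_at (p ^ n) h -> h != 0 -> spread (p ^ n) h != 0.
  move=> hN; apply: contraNneq => h0; apply/eqP/malgP => a; rewrite mcoeff0.
  have [ah|/mcoeff_outdom //] := boolP (a \in msupp h).
  by rewrite -(coef_spread_degree n0 hN ah) h0 coef0.
move=> f0 g0; apply/eqP => fg; have := spreadM fN gN.
by rewrite fg spread0 => /esym/eqP; rewrite mulf_eq0 !(negPf (spread_neq0 _ _ _)).
Qed.

End Spread.

(** * Two non-associate MCDs from a relation [f * g = h * k] *)

Definition coprime_elements (R : comNzRingType) (f g : R) := forall (S : R -> Prop) c,
  S f -> S g -> common_divisor ( *%R : Monoid.com_law (1 : R)) [pred x | x != 0] S c ->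
  is_unit ( *%R : Monoid.com_law (1 : R)) [pred x | x != 0] c.

Lemma mem_seq2 (T : eqType) (x a b : T) : x \in [:: a; b] -> x = a \/ x = b.
Proof. by rewrite !inE => /orP[] /eqP; [left | right]. Qed.

(** The quotients of [x] and [y] by [f] include [g] and [h]; [coprime_elements] allows any set [S]
    containing both, so it applies to the quotient set as it stands. *)
Lemma is_MCD_coprime (R : comNzRingType) (f g h x y : R) :
    f != 0 -> g != 0 -> h != 0 -> x = f * g -> y = f * h -> coprime_elements g h ->
  is_MCD ( *%R : Monoid.com_law (1 : R)) [pred x | x != 0] (fun z => z \in [:: x; y]) f.
Proof.
move=> f0 g0 h0 xE yE gh; split=> [|c]; last first.
  by apply: gh; split=> //; [exists x | exists y]; rewrite ?inE ?eqxx ?orbT.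
split=> // z /mem_seq2[]->; [by exists g | by exists h].
Qed.

(* The common divisors [f] and [h] of [fg] and [fh] are both maximal. *)
Lemma not_q_GCD_domain (R : comNzRingType) (f g h k : R) :
    [/\ f != 0, g != 0, h != 0 & k != 0] -> f * g != 0 -> f * h != 0 -> f * g = h * k ->
    coprime_elements g h -> coprime_elements k f -> (forall u, h <> f * u) ->
  ~ q_GCD_domain R.
Proof.
move=> [f0 g0 h0 k0] fg0 fh0 E gh kf no_div qGCD.
have sP : {subset [:: f * g; f * h] <= [pred x | x != 0]} by move=> x /mem_seq2[]->.
have [u _ /no_div //] := qGCD [:: f * g; f * h] isT sP f h
  (is_MCD_coprime f0 g0 h0 erefl erefl gh) (is_MCD_coprime h0 k0 f0 E (mulrC f h) kf).
Qed.

(** * The elements [R_n] and [D_n] over ['F_p] *)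

Section Counterexample.

Variable p : nat.
Hypothesis p_prime : prime p.
Local Notation q := p.+1.
Local Notation M := (expmon p q).
Local Notation FM := (monoid_algebra 'F_p M).
Local Notation ok k := ((q %| k) || (q < k))%N.

(** If [k] is not an exponent of [M], [insubd] falls back to 0 and this is 1; hence the [ok]
    hypotheses below. *)
Definition monom k : FM := << (insubd (0 : M) k%:R : M) >>.

(** This is [R_n]: starting at [q.+1] puts every exponent above [q], hence in [M]. *)
Definition block n : FM := \sum_(i < n) monom (q.+1 + i).

Definition diff n : FM := monom n - 1.

Lemma expval_monom k : ok k -> expval (insubd (0 : M) k%:R) = k%:R.
Proof. move=> kP; exact: (insubdK (0 : M) (exponent_nat p kP)). Qed.

Lemma monomM j k : ok j -> ok k -> monom j * monom k = monom (j + k).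
Proof.
move=> jP kP; have -> : monom j * monom k = ma_mul (monom j) (monom k) by [].
rewrite ma_mulUU mulr1.
congr << _ *g _ >>; apply: expval_inj.
rewrite expvalD !expval_monom ?natrD //.
case/orP: jP kP => jP /orP[] kP; first by rewrite dvdn_add.
- by rewrite ltn_addl ?orbT.
- by rewrite ltn_addr ?orbT.
- by rewrite ltn_addr ?orbT.
Qed.

(* The right-hand side is symmetric in [n] and [k]. *)
Lemma block_diff n k : ok k ->
  block n * diff k = \sum_(i < k + n) monom (q.+1 + i) - (block n + block k).
Proof.
move=> kP; rewrite big_split_ord /= -/(block k) [block n + _]addrC opprD addrACA subrr add0r.
rewrite /diff mulrBr mulr1 mulr_suml; congr (_ - _).
apply: eq_bigr => i _; rewrite monomM //; last by apply/orP; right; lia.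
by rewrite -addnA [(i + k)%N]addnC.
Qed.

Lemma block_diffC n k : ok n -> ok k -> block n * diff k = block k * diff n.
Proof. by move=> nP kP; rewrite !block_diff // [(k + n)%N]addnC [block n + _]addrC. Qed.

Lemma spread_monom N k : ok k -> spread N (monom k) = 'X^(k * N).
Proof.
by move=> kP; rewrite spreadU scale1r /degree_at expval_monom // -natrM natrK.
Qed.

Lemma spread1 N : spread N (1 : FM) = 1.
Proof. by rewrite spreadU degree_at0 scale1r expr0. Qed.

Lemma spread_diff N k : ok k -> spread N (diff k) = 'X^(k * N) - 1.
Proof. by move=> kP; rewrite spreadB spread1 spread_monom. Qed.

Lemma spread_block N n :
  spread N (block n) = 'X^(q.+1 * N) * \sum_(i < n) 'X^N ^+ i.
Proof.
rewrite spread_sum mulr_sumr; apply: eq_bigr => i _.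
by rewrite spread_monom ?mulnDl ?exprD -?exprM 1?[(N * i)%N]mulnC //; apply/orP; right; lia.
Qed.

Lemma spread_block_mul N n :
  spread N (block n) * ('X^N - 1) = 'X^(q.+1 * N) * ('X^(n * N) - 1).
Proof.
by rewrite spread_block -mulrA [_ * ('X^N - 1)]mulrC -subrX1 -exprM [(N * n)%N]mulnC.
Qed.

Lemma spread_block1 N n : (spread N (block n)).[1] = n%:R.
Proof.
rewrite spread_block hornerM hornerXn expr1n mul1r horner_sum.
under eq_bigr do rewrite -exprM hornerXn expr1n.
by rewrite sumr_const card_ord.
Qed.

Lemma block_neq0 n : (0 < n)%N -> block n != 0.
Proof.
move=> n0; apply/eqP => E; have := spread_block_mul 1 n; rewrite E spread0 mul0r => /esym/eqP.
by rewrite mulf_eq0 -!size_poly_eq0 size_polyXn size_XnsubC ?muln1.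
Qed.

Lemma diff_neq0 n : ok n -> (0 < n)%N -> diff n != 0.
Proof.
move=> nP n0; apply/eqP => E; have := spread_diff 1 nP; rewrite E spread0 => /esym/eqP.
by rewrite -size_poly_eq0 size_XnsubC // muln1.
Qed.

Local Notation divisor := (common_divisor ( *%R : Monoid.com_law (1 : FM)) [pred x | x != 0]).
Local Notation unit_of_FM := (is_unit ( *%R : Monoid.com_law (1 : FM)) [pred x | x != 0]).

(** One power of [p] clears the denominators of [c] and of both cofactors, so the two divisibilities
    become polynomial factorizations. *)
Lemma coprime_of_size_spread (S : FM -> Prop) (f g c : FM) :
    S f -> S g -> divisor S c ->
    (forall N (e e' : FM), p.-nat N -> supported_at N c -> supported_at N e ->
      spread N c * spread N e = spread N f ->
      spread N c * spread N e' = spread N g -> size (spread N c) = 1%N) ->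
  unit_of_FM c.
Proof.
move=> Sf Sg [_ cdiv] size1.
have [[e _ fE] [e' _ gE]] := (cdiv f Sf, cdiv g Sg).
have [n nP] := integral_at_pow (msupp c ++ msupp e ++ msupp e').
have cN : supported_at (p ^ n) c by move=> a ac; apply: nP; rewrite mem_cat ac.
have eN : supported_at (p ^ n) e.
  by move=> a ae; apply: nP; rewrite !mem_cat ae orbT.
have e'N : supported_at (p ^ n) e'.
  by move=> a ae; apply: nP; rewrite !mem_cat ae !orbT.
have pN : p.-nat (p ^ n)%N by rewrite pnatX pnat_id.
apply: (unit_of_size_spread _ cN); first by rewrite expn_gt0 prime_gt0.
by apply: (size1 _ e e') => //; rewrite -spreadM // ?fE ?gE.
Qed.

Lemma coprime_pS : coprime p q.
Proof. by rewrite coprimenS. Qed.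

Lemma ok_sqr : ok (p ^ 2).
Proof. by apply/orP; right; have := prime_gt1 p_prime; nia. Qed.

Lemma ok_q : ok q.
Proof. by rewrite dvdnn. Qed.

Lemma coprime_diff_block_q : coprime_elements (diff q) (block q).
Proof.
move=> S c SD SR cS; apply: (coprime_of_size_spread SD SR cS) => N e e' pN cN eN cE cE'.
have cM := spread_support p_prime coprime_pS pN cN.
have eM := spread_support p_prime coprime_pS pN eN.
apply: (size_factor_subX1_mul (pchar_Fp p_prime) _ pN _ cM eM) => //.
  by rewrite cE spread_diff ?ok_q.
(* The value at 1 is [q = p + 1], which is 1 in ['F_p], and it is a multiple of the value of [c]. *)
have : (spread N (block q)).[1] != 0.
  by rewrite spread_block1 -natr1 pchar_Fp_0 // add0r oner_eq0.
by rewrite -cE' hornerM mulf_eq0 negb_or => /andP[].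
Qed.

Lemma coprime_diff_block_sqr : coprime_elements (diff (p ^ 2)) (block (p ^ 2)).
Proof.
move=> S c SD SR cS; apply: (coprime_of_size_spread SD SR cS) => N e e' pN cN eN cE cE'.
apply: (@size_factor_subX1_sub _ _ (pchar_Fp p_prime) q N (q.+1 * N) _ (spread N e)
  (spread N e') _ coprime_pS pN _ _ (spread_support p_prime coprime_pS pN cN)) => //.
  by rewrite cE spread_diff ?ok_sqr.
by rewrite cE' spread_block_mul.
Qed.

Lemma monoid_algebra_not_qGCD : ~ q_GCD_domain FM.
Proof.
have p20 : (0 < p ^ 2)%N by rewrite expn_gt0 prime_gt0.
have mul0 := @monoid_algebra_mulf_neq0 'F_p p q p_prime.
have [R0 r0] := (block_neq0 p20, block_neq0 (ltn0Sn p)).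
have [D0 d0] := (diff_neq0 ok_sqr p20, diff_neq0 ok_q (ltn0Sn p)).
apply: (not_q_GCD_domain (And4 R0 d0 r0 D0) (mul0 _ _ R0 d0) (mul0 _ _ R0 r0)
  (block_diffC ok_sqr ok_q) coprime_diff_block_q coprime_diff_block_sqr) => u E.
have [n nP] := integral_at_pow (msupp (block (p ^ 2)) ++ msupp u).
(* At 1, [R_q] takes the value 1, whereas any multiple of [R_(p^2)] takes a multiple of [p ^ 2],
   that is 0. *)
have /(congr1 (fun f => f.[1])) := @spreadM _ _ _ (p ^ n) (block (p ^ 2)) u
  (fun a ab => nP a ltac:(by rewrite mem_cat ab))
  (fun a au => nP a ltac:(by rewrite mem_cat au orbT)).
by rewrite -E hornerM !spread_block1 natrX -natr1 pchar_Fp_0 //.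
Qed.

End Counterexample.

Theorem theorem4p4 (p : nat) (p_prime : prime p) :
  exists M : nmodType,
    [/\ cancellative M, torsion_free M & has_rank M 1] /\
    q_GCD_monoid M /\
    ~ q_GCD_domain (monoid_algebra 'F_p M).
Proof.
exists (expmon p p.+1); split; last split.
- split; [exact: expmon_cancellative | exact: expmon_torsion_free | exact: expmon_rank1].
- exact: expmon_qGCD.
- exact: monoid_algebra_not_qGCD.
Qed.
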